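(* Let $M,m$ be coprime positive integers and $m_2\in\mathbf Z$ with $0\le m_2\le m-1$. Let $\Omega^{(\mathrm I)}=\{(k_1,k_2)\in(\mathbf Z_{\ge0})^2:\ 2k_1+k_2\le M-2\}$ and $\Omega^{(\mathrm{III})}=\{(k_1,k_2)\in\mathbf Z_{\ge 0}\times\mathbf Z_{\ge1}:\ 2k_1+k_2\le M-2\}$. Write $\ddot H(\heartsuit)=\overset{N=4}{\ddot H}(\Lambda^{(M)(m,m_2)(\heartsuit)}_{k_1,k_2})$ with $(k_1,k_2)\in\Omega^{(\heartsuit)}$, $\heartsuit\in\{\mathrm I,\mathrm{III}\}$, and $H_2=\overset{N=2}H(\lambda^{(M)[m-1,m_2]}_{k_1,k_1+k_2})$. Then: (I) (i) $\mathrm{ch}^{(+)}_{\ddot H(\mathrm I)}(\tau,z)=i\cdot\mathrm{ch}^{(+)}_{H_2}(\tau,z)\cdot\dfrac{\vartheta_{00}(\tau,z)}{\vartheta_{11}(\tau,2z)}$; (ii) $\mathrm{ch}^{(-)}_{\ddot H(\mathrm I)}(\tau,z)=i\cdot\mathrm{ch}^{(-)}_{H_2}(\tau,z)\cdot\dfrac{\vartheta_{01}(\tau,z)}{\vartheta_{11}(\tau,2z)}$. (III) (i) $\mathrm{ch}^{(+)}_{\ddot H(\mathrm{III})}(\tau,z)=i\cdot\mathrm{ch}^{(+)}_{H_2}(\tau,-z)\cdot\dfrac{\vartheta_{00}(\tau,z)}{\vartheta_{11}(\tau,2z)}$; (ii) $\mathrm{ch}^{(-)}_{\ddot H(\mathrm{III})}(\tau,z)=i\cdot\mathrm{ch}^{(-)}_{H_2}(\tau,-z)\cdot\dfrac{\vartheta_{01}(\tau,z)}{\vartheta_{11}(\tau,2z)}$.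 $(\mathrm I)^{\mathrm{tw}}$ (i) $\mathrm{ch}^{(+)\mathrm{tw}}_{\ddot H(\mathrm I)}(\tau,z)=i\cdot\mathrm{ch}^{(+)\mathrm{tw}}_{H_2}(\tau,-z)\cdot\dfrac{\vartheta_{10}(\tau,z)}{\vartheta_{11}(\tau,2z)}$; (ii) $\mathrm{ch}^{(-)\mathrm{tw}}_{\ddot H(\mathrm I)}(\tau,z)=-i\cdot\mathrm{ch}^{(-)\mathrm{tw}}_{H_2}(\tau,-z)\cdot\dfrac{\vartheta_{11}(\tau,z)}{\vartheta_{11}(\tau,2z)}$.
   Context: Functions. $q=e^{2\pi i\tau}$. For $m\in\frac12\mathbf Z_{>0}$, $s\in\frac12\mathbf Z$: $\Phi^{[m,s]}_1(\tau,z_1,z_2,t)=e^{-2\pi imt}\sum_{j\in\mathbf Z}\frac{e^{2\pi imj(z_1+z_2)+2\pi isz_1}q^{mj^2+sj}}{1-e^{2\pi iz_1}q^j}$, $\Phi^{[m,s]}_2(\tau,z_1,z_2,t)=e^{-2\pi imt}\sum_{j\in\mathbf Z}\frac{e^{-2\pi imj(z_1+z_2)-2\pi isz_2}q^{mj^2+sj}}{1-e^{-2\pi iz_2}q^j}$, $\Phi^{[m,s]}=\Phi^{[m,s]}_1-\Phi^{[m,s]}_2$. For $\varepsilon,\varepsilon'\in\{0,\frac12\}$ and $j,k\in\varepsilon'+\mathbf Z$: $\Psi^{[M,m,s;\varepsilon]}_{j,k;\varepsilon'}(\tau,z_1,z_2,t)=q^{\frac mMjk}e^{\frac{2\pi im}{M}(kz_1+jz_2)}\Phi^{[m,s]}(M\tau,z_1+j\tau+\varepsilon,z_2+k\tau-\varepsilon,\frac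 tM)$. $\vartheta_{ab}(\tau,z)=\sum_{n\in\mathbf Z}e^{\pi i(n+\frac a2)^2\tau+2\pi i(n+\frac a2)(z+\frac b2)}$ (Mumford), $\eta(\tau)=q^{1/24}\prod_{n\ge1}(1-q^n)$. Affine superalgebra. $\widehat A(1,1)$ is the affine Lie superalgebra of $sl(2|2)/\mathbf CI$ with simple roots $\alpha_0,\alpha_2$ (even), $\alpha_1,\alpha_3$ (odd), and $(\alpha_0|\alpha_0)=2$, $(\alpha_2|\alpha_2)=-2$, $(\alpha_1|\alpha_1)=(\alpha_3|\alpha_3)=(\alpha_1|\alpha_3)=(\alpha_0|\alpha_2)=0$, $(\alpha_0|\alpha_1)=(\alpha_0|\alpha_3)=-1$, $(\alpha_1|\alpha_2)=(\alpha_2|\alpha_3)=1$ (so $\alpha_1,\alpha_3$ coincide as functions on the Cartan subalgebra). $\delta=\sum_{i=0}^3\alpha_i$, $\theta=\alpha_1+\alpha_2+\alpha_3$, $(\Lambda_0|\alpha_j)=\delta_{j,0}$, $(\Lambda_0|\Lambda_0)=0$, $\rho=-\frac12(\alpha_1+\alpha_3)$, dual Coxeter number $0$. The Cartan subalgebra is identified with its dual via $(\cdot|\cdot)$, with coordinates $(\tau,z_1,z_2,t)=2\pi i(-\tau\Lambda_0+z+t\delta)$, $z=-\frac{z_1-z_2}2(\alpha_1+\alpha_3)-z_1\alpha_2$; thus $e^{-\alpha_1}=e^{-\alpha_3}=e^{2\pi iz_1}$, $e^{-\alpha_2}=e^{-2\pi i(z_1+z_2)}$, $e^{\Lambda_0}=e^{2\pi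 it}$, $e^{-\delta}=q$. Put $t_\alpha(\lambda)=\lambda+(\lambda|\delta)\alpha-\{\frac{(\alpha|\alpha)}2(\lambda|\delta)+(\lambda|\alpha)\}\delta$, $r_\theta(\lambda)=\lambda-(\lambda|\theta)\theta$, $r_{\alpha_2}(\lambda)=\lambda+(\lambda|\alpha_2)\alpha_2$, and $w.\lambda=w(\lambda+\rho)-\rho$. Characters of modules. All characters are normalized (super)characters ($+$: character, $-$: supercharacter), $\widehat R^{(\pm)}$ is the (super)denominator, and ''numerator'' means the product $\widehat R^{(\pm)}\mathrm{ch}^{(\pm)}$. They are given by the following formulas. For $0\le m_2\le m$ let $\Lambda^{(m,m_2)}=m\Lambda_0+\frac{m_2}2(\alpha_1+\alpha_3)$ and $F^{(\pm)}=\sum_{j\in\mathbf Z}t_{j\theta}\Big(\frac{e^{\Lambda^{(m,m_2)}+\rho}}{(1\pm e^{-\alpha_1})(1\pm e^{-\alpha_3})}\Big)$; then $\widehat R^{(\pm)}\mathrm{ch}^{(\pm)}_{L(\Lambda^{(m,m_2)})}=F^{(\pm)}-r_\theta F^{(\pm)}$. For $\beta=\beta[b_1,b_2]:=-\frac{b_1-b_2}2(\alpha_1+\alpha_3)-b_1\alpha_2$ and a type $\heartsuit$ put: (I) $\overline y=1$, $\beta=\beta[k_1,-(k_1+k_2)]$; (III) $\overline y=r_{\alpha_2}$, $\beta=\beta[k_1+k_2,-k_1]$. The principal admissible weight is $\Lambda^{(M)(m,m_2)(\heartsuit)}_{k_1,k_2}=(t_\beta\overline y).(\Lambda^{(m,m_2)}-(M-1)\frac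 mM\Lambda_0)$ and its irreducible highest weight module has $[\widehat R^{(\pm)}\mathrm{ch}^{(\pm)}_{L(\Lambda^{(M)(m,m_2)(\heartsuit)}_{k_1,k_2})}](\tau,z,t)=[\widehat R^{(\pm)}\mathrm{ch}^{(\pm)}_{L(\Lambda^{(m,m_2)})}]\big(M\tau,\overline y^{-1}(z+\tau\beta),\frac1M(t+(z|\beta)+\frac{\tau|\beta|^2}2)\big)$. Twisted functions are $f^{\mathrm{tw}}(h)=f(w_0h)$ with $w_0=r_{\alpha_2}t_{-\frac12\alpha_2}$, i.e. $w_0(\tau,z_1,z_2,t)=(\tau,-z_2+\frac\tau2,-z_1+\frac\tau2,t+\frac{z_1+z_2}2-\frac\tau4)$. For $0\le m_2\le m-1$, $\ddot L(\Lambda^{(M)(m,m_2)(\heartsuit)}_{k_1,k_2})=L(\Lambda^{(M)(m,m_2)(\heartsuit)}_{k_1,k_2})\oplus L(\Lambda^{(M)(m,m_2+1)(\heartsuit)}_{k_1,k_2})$, with $\mathrm{ch}^{(\pm)}_{\ddot L}=\mathrm{ch}^{(\pm)}_{L(\Lambda^{(M)(m,m_2)(\heartsuit)}_{k_1,k_2})}\pm\mathrm{ch}^{(\pm)}_{L(\Lambda^{(M)(m,m_2+1)(\heartsuit)}_{k_1,k_2})}$ and the same for twisted characters. N=4 characters. $\overset{N=4}{\ddot H}(\Lambda)$ is the quantum Hamiltonian reduction of $\ddot L(\Lambda)$ for $(x=\frac12\theta,f=e_{-\theta})$, a module of the N=4 superconformal algebra of central charge $-6(\frac mM+1)$. Its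 characters are given by $[\overset{N=4}R{}^{(\pm)}\mathrm{ch}^{(\pm)}_{\ddot H}](\tau,z)=[\widehat R^{(\pm)}\mathrm{ch}^{(\pm)}_{\ddot L}](\tau,z+\frac\tau2,z-\frac\tau2,\frac\tau4)$, and likewise with ''tw'' throughout, where the N=4 denominators are $\overset{N=4}R{}^{(+)}=-i\frac{\eta(\tau)^3\vartheta_{11}(\tau,2z)}{\vartheta_{00}(\tau,z)^2}$, $\overset{N=4}R{}^{(-)}=i\frac{\eta(\tau)^3\vartheta_{11}(\tau,2z)}{\vartheta_{01}(\tau,z)^2}$, $\overset{N=4}R{}^{(+)\mathrm{tw}}=-i\frac{\eta(\tau)^3\vartheta_{11}(\tau,2z)}{\vartheta_{10}(\tau,z)^2}$, $\overset{N=4}R{}^{(-)\mathrm{tw}}=i\frac{\eta(\tau)^3\vartheta_{11}(\tau,2z)}{\vartheta_{11}(\tau,z)^2}$. N=2 characters. Let $\widehat{sl}(2|1)$ have simple roots $\alpha_0$ (even), $\alpha_1,\alpha_2$ (odd) with $(\alpha_0|\alpha_0)=2$, $(\alpha_0|\alpha_1)=(\alpha_0|\alpha_2)=-1$, $(\alpha_1|\alpha_2)=1$, $(\alpha_1|\alpha_1)=(\alpha_2|\alpha_2)=0$ and $\delta=\alpha_0+\alpha_1+\alpha_2$. For integers $0\le m_2\le m'$, $k_1,k_2\ge0$, $k_1+k_2\le M-1$, $\gcd(M,m'+1)=1$ and $K=\frac{m'+1}M-1$, $\lambda^{(M)[m',m_2]}_{k_1,k_2}=K\Lambda_0-(K+1)k_1\alpha_2-(K+1)(k_2-\frac{m_2}{K+1})\alpha_1-(K+1)k_1(k_2-\frac{m_2}{K+1})\delta$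 is a principal admissible weight of level $K$. $\overset{N=2}H(\lambda)$ denotes the quantum Hamiltonian reduction of the irreducible highest weight module $L(\lambda)$ with $x=\frac12(\alpha_1+\alpha_2)$ and the minimal nilpotent element, a module of the N=2 superconformal algebra; ''tw'' refers to the Ramond twisted module. Its normalized (super)characters, for $\lambda=\lambda^{(M)[m',m_2]}_{k_1,k_2}$, are (known formulas) $\mathrm{ch}^{(+)}(\tau,z)=(-1)^{m_2}\Psi^{[M,m'+1,-m_2;\frac12]}_{k_1+\frac12,k_2+\frac12;\frac12}(\tau,z,-z,0)\frac{\vartheta_{00}(\tau,z)}{\eta(\tau)^3}$, $\mathrm{ch}^{(-)}(\tau,z)=\Psi^{[M,m'+1,-m_2;0]}_{k_1+\frac12,k_2+\frac12;\frac12}(\tau,z,-z,0)\frac{\vartheta_{01}(\tau,z)}{\eta(\tau)^3}$, $\mathrm{ch}^{(+)\mathrm{tw}}(\tau,z)=(-1)^{m_2}\Psi^{[M,m'+1,-m_2;\frac12]}_{k_1+1,k_2;0}(\tau,z,-z,0)\frac{\vartheta_{10}(\tau,z)}{\eta(\tau)^3}$, $\mathrm{ch}^{(-)\mathrm{tw}}(\tau,z)=\Psi^{[M,m'+1,-m_2;0]}_{k_1+1,k_2;0}(\tau,z,-z,0)\frac{\vartheta_{11}(\tau,z)}{\eta(\tau)^3}$. *)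

(* Defs.v *)
From Stdlib Require Export Reals ZArith.
From Coquelicot Require Export Coquelicot.

#[global] Open Scope R_scope.
#[global] Open Scope C_scope.

Coercion ZtoC (n : Z) : C := RtoC (IZR n).

Definition cexp (w : C) : C :=
  (exp (Re w) * cos (Im w), exp (Re w) * sin (Im w))%R.

(* Every sum over Z below converges absolutely wherever it is used, so that
   the order of summation is immaterial. *)
Definition Cseries (a : nat -> C) : C :=
  (Series (fun n => Re (a n)), Series (fun n => Im (a n))).

Definition Zsum (f : Z -> C) : C :=
  Cseries (fun n => f (Z.of_nat n)) + Cseries (fun n => f (- Z.of_nat (S n))%Z).

Fixpoint Cprod (a : nat -> C) (n : nat) : C :=
  match n with O => 1 | S p => Cprod a p * a p end.

Definition Cinfprod (a : nat -> C) : C :=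
  (real (Lim_seq (fun n => Re (Cprod a n))),
   real (Lim_seq (fun n => Im (Cprod a n)))).

(* q^x, with the branch fixed by tau *)
Definition qpow (tau x : C) : C := cexp (2 * PI * Ci * tau * x).

Definition vartheta (a b : Z) (tau z : C) : C :=
  Zsum (fun n => cexp (PI * Ci * ((n + a / 2) * (n + a / 2)) * tau
                       + 2 * PI * Ci * (n + a / 2) * (z + b / 2))).

Definition eta (tau : C) : C :=
  qpow tau (1 / 24) * Cinfprod (fun n => 1 - qpow tau (Z.of_nat (S n))).

(* m and s range over half-integers, m > 0. *)
Definition Phi1 (m s : R) (tau z1 z2 t : C) : C :=
  cexp (- (2 * PI * Ci * m * t)) *
  Zsum (fun j =>
    cexp (2 * PI * Ci * m * j * (z1 + z2) + 2 * PI * Ci * s * z1)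
    * qpow tau (m * j * j + s * j)
    / (1 - cexp (2 * PI * Ci * z1) * qpow tau j)).

Definition Phi2 (m s : R) (tau z1 z2 t : C) : C :=
  cexp (- (2 * PI * Ci * m * t)) *
  Zsum (fun j =>
    cexp (- (2 * PI * Ci * m * j * (z1 + z2)) - 2 * PI * Ci * s * z2)
    * qpow tau (m * j * j + s * j)
    / (1 - cexp (- (2 * PI * Ci * z2)) * qpow tau j)).

Definition Phi (m s : R) (tau z1 z2 t : C) : C :=
  Phi1 m s tau z1 z2 t - Phi2 m s tau z1 z2 t.

(* The customary last index eps' of Psi only records the common class of
   j and k modulo Z, hence is not an argument. *)
Definition Psi (M m s eps j k : R) (tau z1 z2 t : C) : C :=
  qpow tau (m / M * j * k) * cexp (2 * PI * Ci * m / M * (k * z1 + j * z2))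
  * Phi m s (M * tau) (z1 + j * tau + eps) (z2 + k * tau - eps) (t / M).

(* The Cartan subalgebra of A(1,1)^, identified with its dual: (x, a, b, d)
   stands for x Lambda0 + a alpha1 + b alpha2 + d delta; alpha3 and alpha1
   coincide as functions on it. *)
Record hvec := HVec { cLam : C; ca1 : C; ca2 : C; cdel : C }.

Definition hadd (u v : hvec) : hvec :=
  HVec (cLam u + cLam v) (ca1 u + ca1 v) (ca2 u + ca2 v) (cdel u + cdel v).
Definition hscal (c : C) (u : hvec) : hvec :=
  HVec (c * cLam u) (c * ca1 u) (c * ca2 u) (c * cdel u).
Definition hopp (u : hvec) : hvec := hscal (- (1)) u.

Declare Scope hvec_scope.
Delimit Scope hvec_scope with h.
Bind Scope hvec_scope with hvec.
Infix "+" := hadd : hvec_scope.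
Notation "- u" := (hopp u) : hvec_scope.
Notation "u - v" := (hadd u (hopp v)) : hvec_scope.
Notation "c *: u" := (hscal c%C u%h) (at level 40, left associativity)
  : hvec_scope.

Definition Lambda0 : hvec := HVec 1 0 0 0.
Definition alpha1 : hvec := HVec 0 1 0 0.
Definition alpha2 : hvec := HVec 0 0 1 0.
Definition alpha3 : hvec := alpha1.
Definition delta : hvec := HVec 0 0 0 1.
Definition alpha0 : hvec := (delta - alpha1 - alpha2 - alpha3)%h.
Definition theta : hvec := (alpha1 + alpha2 + alpha3)%h.
Definition rho : hvec := (- (1 / 2) *: (alpha1 + alpha3))%h.

(* The nonzero products of basis vectors are (Lambda0|delta) = 1,
   (alpha1|alpha2) = 1 and (alpha2|alpha2) = -2. *)
Definition hdot (u v : hvec) : C :=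
  cLam u * cdel v + cdel u * cLam v
  + ca1 u * ca2 v + ca2 u * ca1 v - 2 * (ca2 u * ca2 v).

Lemma gram_simple_roots :
  hdot alpha0 alpha0 = 2 /\ hdot alpha2 alpha2 = -2 /\
  hdot alpha1 alpha1 = 0 /\ hdot alpha0 alpha2 = 0 /\
  hdot alpha0 alpha1 = -1 /\ hdot alpha1 alpha2 = 1 /\
  hdot Lambda0 alpha0 = 1 /\ hdot Lambda0 alpha1 = 0 /\
  hdot Lambda0 alpha2 = 0 /\ hdot Lambda0 Lambda0 = 0.
Proof.
  repeat split; unfold hdot; simpl; apply injective_projections; simpl; ring.
Qed.

Definition hexp (lam h : hvec) : C := cexp (hdot lam h).

Definition transl (alpha lam : hvec) : hvec :=
  (lam + hdot lam delta *: alpha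
   - (hdot alpha alpha / 2 * hdot lam delta + hdot lam alpha) *: delta)%h.
Definition r_theta (lam : hvec) : hvec := (lam - hdot lam theta *: theta)%h.
Definition r_alpha2 (lam : hvec) : hvec := (lam + hdot lam alpha2 *: alpha2)%h.
Definition dot_act (w : hvec -> hvec) (lam : hvec) : hvec :=
  (w (lam + rho) - rho)%h.

(* beta[b1,b2]; also the finite part z of the point (tau, z1, z2, t), with
   b1 = z1 and b2 = z2. *)
Definition beta (b1 b2 : C) : hvec :=
  (- ((b1 - b2) / 2) *: (alpha1 + alpha3) - b1 *: alpha2)%h.

Definition hpt (tau : C) (z : hvec) (t : C) : hvec :=
  (2 * PI * Ci *: (- tau *: Lambda0 + z + t *: delta))%h.
Definition tau_of (h : hvec) : C := - (cLam h / (2 * PI * Ci)).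
Definition z_of (h : hvec) : hvec :=
  HVec 0 (ca1 h / (2 * PI * Ci)) (ca2 h / (2 * PI * Ci)) 0.
Definition t_of (h : hvec) : C := cdel h / (2 * PI * Ci).

Definition w0 (h : hvec) : hvec := r_alpha2 (transl (- (1 / 2) *: alpha2) h).

Lemma betaE (b1 b2 : C) : beta b1 b2 = HVec 0 (b2 - b1) (- b1) 0.
Proof.
  unfold beta, hopp, hscal, hadd; simpl.
  f_equal; field.
Qed.

Lemma r_alpha2_hpt (tau z1 z2 t : C) :
  r_alpha2 (hpt tau (beta z1 z2) t) = hpt tau (beta (- z2) (- z1)) t.
Proof.
  unfold hpt; generalize (RtoC 2 * PI * Ci) as c; intro c; rewrite !betaE.
  unfold r_alpha2, hdot, hscal, hadd;
    cbn [cLam ca1 ca2 cdel alpha2 Lambda0 delta].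
  f_equal; ring.
Qed.

Lemma transl_hpt (tau z1 z2 t : C) :
  transl (- (1 / 2) *: alpha2)%h (hpt tau (beta z1 z2) t) =
  hpt tau (beta (z1 - tau / 2) (z2 - tau / 2)) (t + (z1 + z2) / 2 - tau / 4).
Proof.
  unfold hpt; generalize (RtoC 2 * PI * Ci) as c; intro c; rewrite !betaE.
  replace (- (1 / 2) *: alpha2)%h with (HVec 0 0 (- (1 / 2)) 0)
    by (unfold hscal; simpl; f_equal; ring).
  unfold transl, hdot, hopp, hscal, hadd;
    cbn [cLam ca1 ca2 cdel alpha2 Lambda0 delta].
  f_equal; field.
Qed.

Lemma w0_hpt (tau z1 z2 t : C) :
  w0 (hpt tau (beta z1 z2) t) =
  hpt tau (beta (- z2 + tau / 2) (- z1 + tau / 2))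
      (t + (z1 + z2) / 2 - tau / 4).
Proof.
  unfold w0; rewrite transl_hpt, r_alpha2_hpt.
  replace (- (z2 - tau / 2)) with (- z2 + tau / 2) by ring.
  now replace (- (z1 - tau / 2)) with (- z1 + tau / 2) by ring.
Qed.

Inductive sgn := Plus | Minus. (* character / supercharacter *)
Coercion sgnC (s : sgn) : C := match s with Plus => 1 | Minus => - (1) end.

(* An irreducible highest weight module is represented by its highest weight
   together with its numerators R^(s) ch^(s). *)
Record hw_module := HWModule { hw : hvec; Rch : sgn -> hvec -> C }.

Definition Lambda_mm2 (m m2 : Z) : hvec :=
  (m *: Lambda0 + m2 / 2 *: (alpha1 + alpha3))%h.

(* A Weyl group element w acts on functions by (w f)(h) = f (w^-1 h). *)
Definition Fsum (s : sgn) (m m2 : Z) (h : hvec) : C :=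
  let f (u : hvec) :=
    hexp (Lambda_mm2 m m2 + rho) u
    / ((1 + s * hexp (- alpha1) u) * (1 + s * hexp (- alpha3) u)) in
  Zsum (fun j => f (transl (- (j) *: theta) h)).

Definition L_mm2 (m m2 : Z) : hw_module :=
  HWModule (Lambda_mm2 m m2)
    (fun s h => Fsum s m m2 h - Fsum s m m2 (r_theta h)).

Inductive heart := TypeI | TypeIII.

(* ybar is an involution, so it also stands for its inverse. *)
Definition ybar (ty : heart) : hvec -> hvec :=
  match ty with TypeI => fun u => u | TypeIII => r_alpha2 end.
Definition beta_of (ty : heart) (k1 k2 : Z) : hvec :=
  match ty with
  | TypeI => beta k1 (- (k1 + k2))
  | TypeIII => beta (k1 + k2) (- (k1))
  end.

Definition L_adm (M m m2 : Z) (ty : heart) (k1 k2 : Z) : hw_module :=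
  let b := beta_of ty k1 k2 in
  HWModule
    (dot_act (fun u => transl b (ybar ty u))
       (Lambda_mm2 m m2 - ((M - 1) * (m / M)) *: Lambda0)%h)
    (fun s h =>
       let tau := tau_of h in
       let z := z_of h in
       let t := t_of h in
       Rch (L_mm2 m m2) s
         (hpt (M * tau) (ybar ty (z + tau *: b)%h)
              (1 / M * (t + hdot z b + tau * hdot b b / 2)))).

Definition Rch_Lddot (M m m2 : Z) (ty : heart) (k1 k2 : Z)
    (s : sgn) (h : hvec) : C :=
  Rch (L_adm M m m2 ty k1 k2) s h + s * Rch (L_adm M m (m2 + 1) ty k1 k2) s h.
Definition Rch_Lddot_tw (M m m2 : Z) (ty : heart) (k1 k2 : Z)
    (s : sgn) (h : hvec) : C :=
  Rch_Lddot M m m2 ty k1 k2 s (w0 h).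

Definition N4_R (s : sgn) (tau z : C) : C :=
  match s with
  | Plus => - Ci * (eta tau ^ 3 * vartheta 1 1 tau (2 * z)
                    / vartheta 0 0 tau z ^ 2)
  | Minus => Ci * (eta tau ^ 3 * vartheta 1 1 tau (2 * z)
                   / vartheta 0 1 tau z ^ 2)
  end.
Definition N4_R_tw (s : sgn) (tau z : C) : C :=
  match s with
  | Plus => - Ci * (eta tau ^ 3 * vartheta 1 1 tau (2 * z)
                    / vartheta 1 0 tau z ^ 2)
  | Minus => Ci * (eta tau ^ 3 * vartheta 1 1 tau (2 * z)
                   / vartheta 1 1 tau z ^ 2)
  end.

Definition N4_pt (tau z : C) : hvec :=
  hpt tau (beta (z + tau / 2) (z - tau / 2)) (tau / 4).

Definition N4_ch (s : sgn) (M m m2 : Z) (ty : heart) (k1 k2 : Z)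
    (tau z : C) : C :=
  Rch_Lddot M m m2 ty k1 k2 s (N4_pt tau z) / N4_R s tau z.
Definition N4_ch_tw (s : sgn) (M m m2 : Z) (ty : heart) (k1 k2 : Z)
    (tau z : C) : C :=
  Rch_Lddot_tw M m m2 ty k1 k2 s (N4_pt tau z) / N4_R_tw s tau z.

(* Coordinates in the basis Lambda0, alpha1, alpha2, delta of sl(2|1)^,
   where alpha1 and alpha2 are the odd simple roots *)
Record sl21_weight :=
  Sl21Weight { wLam : C; wa1 : C; wa2 : C; wdel : C }.

Definition lambda_N2 (M m' m2 k1 k2 : Z) : sl21_weight :=
  let K : C := (m' + 1) / M - 1 in
  Sl21Weight K
    (- ((K + 1) * (k2 - m2 / (K + 1))))
    (- ((K + 1) * k1))
    (- ((K + 1) * k1 * (k2 - m2 / (K + 1)))).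

(* The quantum Hamiltonian reduction of L(lambda) is represented by lambda and
   its normalized (super)characters, untwisted and Ramond twisted. *)
Record N2_module := N2Module
  { N2_hw : sl21_weight;
    N2_ch : sgn -> C -> C -> C;
    N2_ch_tw : sgn -> C -> C -> C }.

Definition N2_H (M m' m2 k1 k2 : Z) : N2_module :=
  let P eps j k tau z :=
    Psi (IZR M) (IZR (m' + 1)) (IZR (- m2)) eps j k tau z (- z) 0 in
  N2Module (lambda_N2 M m' m2 k1 k2)
    (fun s tau z =>
       match s with
       | Plus =>
           powerRZ (-1) m2 * P (1 / 2)%R (IZR k1 + 1 / 2)%R (IZR k2 + 1 / 2)%R tau z
           * (vartheta 0 0 tau z / eta tau ^ 3)
       | Minus =>
           P 0%R (IZR k1 + 1 / 2)%R (IZR k2 + 1 / 2)%R tau z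
           * (vartheta 0 1 tau z / eta tau ^ 3)
       end)
    (fun s tau z =>
       match s with
       | Plus =>
           powerRZ (-1) m2 * P (1 / 2)%R (IZR k1 + 1)%R (IZR k2) tau z
           * (vartheta 1 0 tau z / eta tau ^ 3)
       | Minus =>
           P 0%R (IZR k1 + 1)%R (IZR k2) tau z
           * (vartheta 1 1 tau z / eta tau ^ 3)
       end).

Definition Omega (ty : heart) (M k1 k2 : Z) : Prop :=
  match ty with
  | TypeI => (0 <= k1 /\ 0 <= k2 /\ 2 * k1 + k2 <= M - 2)%Z
  | TypeIII => (0 <= k1 /\ 1 <= k2 /\ 2 * k1 + k2 <= M - 2)%Z
  end.

(* Main.v *)
Require Import Defs.
From Stdlib Require Import Lra Lia.

(** Both sides of every identity are the same Appell function Phi^[m,-m2],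
    up to elementary factors.

    Expand the numerator of L(Lambda^(m,m2)) at the point (tau, z1, z2, t) and
    put x_j = e^(2 pi i (z1 - j tau)).  The j-th term of F is
    e^(w_j) x_j / (1 + s x_j)^2, where s is the sign of the (super)character,
    and raising m2 by one divides the numerator by x_j, which leaves
    e^(w_j) / (1 + s x_j)^2.  Adding the two with the sign s gives the
    numerator e^(w_j) (x_j + s) = s e^(w_j) (1 + s x_j), so that the direct sum
    of the two modules has only simple poles:
    F^(m2) + s F^(m2+1) = s sum_j e^(w_j) / (1 + s x_j).
    After j is replaced by -j this is Phi_1 at (z1, -z2, -t) for s = -1; for
    s = +1 the sign in the denominator is absorbed by a shift of the two
    arguments by 1/2, at the cost of a factor (-1)^m2 ([Fsum_pair]).  The
    reflection r_theta exchanges z1 and z2, which turns Phi_1 into Phi_2, so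
    F - r_theta F gives Phi = Phi_1 - Phi_2 ([L_pair]).

    Passing to the principal admissible weight multiplies tau by M and
    translates (z1, z2) by multiples of tau.  These are exactly the changes of
    variables in the definition of Psi, and the exponential prefactor of Psi is
    what the translated coordinate t contributes through the factor
    e^(-2 pi i m t) of Phi ([Rch_Lddot_Psi]).  What remains is to specialize
    (z1, z2, t) and to compare the N=4 and N=2 denominators
    ([Cdiv_denominator]), using the parity of the theta functions
    ([vartheta_opp]) where z is replaced by -z.

    Splitting and reindexing the sums over the integers needs absolute
    convergence, which comes from the Gaussian factor |q^(m j^2)|: it beats any
    linear exponent, while the denominators 1 + s x_j stay at distance at least
    1/2 from zero for large |j| ([Zsummable_gauss], [pole_bound_far]).  Since
    the inverse of zero is zero, the cancellation of 1 + s x_j and the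
    rearrangement of the denominators hold even where a factor vanishes. *)

(** * Complex inverses and exponentials *)

Lemma C_eq (x y : C) : Re x = Re y -> Im x = Im y -> x = y.
Proof. destruct x, y; simpl; congruence. Qed.

Lemma Cinv_0 : / (RtoC 0) = 0.
Proof. apply injective_projections; simpl; unfold Rdiv; ring. Qed.

(** Unconditional because the inverse of zero is zero. *)
Lemma Cinv_mult (x y : C) : / (x * y) = / x * / y.
Proof.
  destruct (Ceq_dec x 0) as [->|hx].
  { replace (0 * y) with (RtoC 0) by ring. rewrite Cinv_0. ring. }
  destruct (Ceq_dec y 0) as [->|hy].
  { replace (x * 0) with (RtoC 0) by ring. rewrite Cinv_0. ring. }
  now field.
Qed.

Lemma Cinv_inv (x : C) : / / x = x.
Proof.
  destruct (Ceq_dec x 0) as [->|hx]; [now rewrite !Cinv_0 | now field].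
Qed.

Lemma Cdiv_sqr_self (x : C) : x / (x * x) = / x.
Proof.
  unfold Cdiv; destruct (Ceq_dec x 0) as [->|hx]; [rewrite Cinv_0; ring | now field].
Qed.

Lemma cexp_add (x y : C) : cexp (x + y) = cexp x * cexp y.
Proof.
  destruct x as [a b], y as [c d]. unfold cexp, Cmult; cbn [Re Im fst snd Cplus].
  rewrite exp_plus, cos_plus, sin_plus. f_equal; ring.
Qed.

Lemma cexp_0 : cexp 0 = 1.
Proof.
  unfold cexp; simpl. rewrite exp_0, cos_0, sin_0.
  unfold RtoC; f_equal; ring.
Qed.

Lemma Cmod_cexp (x : C) : Cmod (cexp x) = exp (Re x).
Proof.
  unfold Cmod, cexp; cbn [fst snd].
  replace (_ + _)%R with (exp (Re x) * exp (Re x) * ((sin (Im x))² + (cos (Im x))²))%R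
    by (unfold Rsqr; ring).
  rewrite sin2_cos2, Rmult_1_r. apply sqrt_square, Rlt_le, exp_pos.
Qed.

Lemma cexp_piZ (n : Z) : cexp (PI * Ci * n) = powerRZ (-1) n.
Proof.
  assert (e1 : cexp (PI * Ci) = - (1)).
  { unfold cexp; simpl.
    replace (PI * 0 - 0 * 1)%R with 0%R by ring.
    replace (PI * 1 + 0 * 0)%R with PI by ring.
    rewrite exp_0, cos_PI, sin_PI. unfold RtoC, Copp; simpl. f_equal; ring. }
  assert (s : forall k : Z, RtoC (powerRZ (-1) (k + 1)) = - powerRZ (-1) k).
  { intro k. rewrite powerRZ_add by lra. rewrite powerRZ_1, <- RtoC_opp. f_equal. ring. }
  induction n as [|n IH|n IH] using Z.peano_ind.
  - simpl. rewrite <- cexp_0. f_equal. unfold ZtoC. ring.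
  - rewrite <- Z.add_1_r, s, <- IH.
    replace (PI * Ci * (n + 1)%Z) with (PI * Ci + PI * Ci * n)
      by (unfold ZtoC; rewrite plus_IZR, RtoC_plus; ring).
    rewrite cexp_add, e1. ring.
  - rewrite <- (Z.sub_add 1 n), s in IH. rewrite <- Z.sub_1_r.
    replace (n - 1 + 1)%Z with n in IH by ring.
    replace (PI * Ci * n) with (PI * Ci + PI * Ci * (n - 1)%Z) in IH
      by (unfold ZtoC; rewrite minus_IZR, RtoC_minus; ring).
    rewrite cexp_add, e1 in IH.
    replace (cexp (PI * Ci * (n-1)%Z)) with (- (- (1) * cexp (PI * Ci * (n - 1)%Z))) by ring.
    rewrite IH. ring.
Qed.

Lemma powerRZ_m1_sqr (n : Z) : powerRZ (-1) n * powerRZ (-1) n = 1.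
Proof.
  rewrite <- RtoC_mult, <- powerRZ_mult.
  replace (-1 * -1)%R with 1%R by ring.
  now rewrite powerRZ_R1.
Qed.

(** * Absolutely convergent sums over the integers *)

Definition Zsummable (f : Z -> C) : Prop :=
  ex_series (fun n : nat => Cmod (f (Z.of_nat n))) /\
  ex_series (fun n : nat => Cmod (f (- Z.of_nat (S n))%Z)).

Lemma im_le_Cmod (c : C) : (Rabs (Im c) <= Cmod c)%R.
Proof. eapply Rle_trans; [apply Rmax_r | apply Rmax_Cmod]. Qed.

Lemma ex_series_Re (a : nat -> C) :
  ex_series (fun n => Cmod (a n)) -> ex_series (fun n => Re (a n)).
Proof. apply (ex_series_le (V := R_CompleteNormedModule)). intro n; apply re_le_Cmod. Qed.

Lemma ex_series_Im (a : nat -> C) :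
  ex_series (fun n => Cmod (a n)) -> ex_series (fun n => Im (a n)).
Proof. apply (ex_series_le (V := R_CompleteNormedModule)). intro n; apply im_le_Cmod. Qed.

Lemma Cseries_plus (a b : nat -> C) :
  ex_series (fun n => Cmod (a n)) -> ex_series (fun n => Cmod (b n)) ->
  Cseries (fun n => a n + b n) = Cseries a + Cseries b.
Proof.
  intros ha hb. apply C_eq; simpl; apply Series_plus;
    now (apply ex_series_Re || apply ex_series_Im).
Qed.

Lemma Cseries_scal (c : C) (a : nat -> C) :
  ex_series (fun n => Cmod (a n)) ->
  Cseries (fun n => c * a n) = c * Cseries a.
Proof.
  intros ha. pose proof (ex_series_Re a ha). pose proof (ex_series_Im a ha).
  apply C_eq; cbn [Cseries Re Im fst snd Cmult];
    rewrite <- !Series_scal_l.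
  - rewrite <- Series_minus; [reflexivity| |];
      now apply (ex_series_scal_l (V := R_NormedModule)).
  - rewrite <- Series_plus; [reflexivity| |];
      now apply (ex_series_scal_l (V := R_NormedModule)).
Qed.

Lemma Cseries_ext (a b : nat -> C) :
  (forall n, a n = b n) -> Cseries a = Cseries b.
Proof.
  intro h. unfold Cseries. f_equal; apply Series_ext; intro n; now rewrite h.
Qed.

Lemma Cseries_incr_1 (a : nat -> C) :
  ex_series (fun n => Cmod (a n)) ->
  Cseries a = a 0%nat + Cseries (fun n => a (S n)).
Proof.
  intro ha. apply C_eq; simpl; apply Series_incr_1;
    now (apply ex_series_Re || apply ex_series_Im).
Qed.

Lemma Zsum_ext (f g : Z -> C) : (forall j, f j = g j) -> Zsum f = Zsum g.
Proof. intro h. unfold Zsum. f_equal; apply Cseries_ext; intro n; apply h. Qed.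

Lemma Zsummable_ext (f g : Z -> C) : (forall j, f j = g j) -> Zsummable f -> Zsummable g.
Proof.
  intros h [h1 h2]. split.
  - now eapply ex_series_ext; [intro n; rewrite <- h; reflexivity|].
  - now eapply ex_series_ext; [intro n; rewrite <- h; reflexivity|].
Qed.

Lemma Zsum_plus (f g : Z -> C) :
  Zsummable f -> Zsummable g -> Zsum (fun j => f j + g j) = Zsum f + Zsum g.
Proof.
  intros [f1 f2] [g1 g2]. unfold Zsum. rewrite !Cseries_plus by assumption. ring.
Qed.

Lemma Zsum_scal (c : C) (f : Z -> C) :
  Zsummable f -> Zsum (fun j => c * f j) = c * Zsum f.
Proof.
  intros [f1 f2]. unfold Zsum. rewrite !Cseries_scal by assumption. ring.
Qed.

Lemma Zsummable_scal (c : C) (f : Z -> C) : Zsummable f -> Zsummable (fun j => c * f j).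
Proof.
  intros [h1 h2].
  split; [revert h1 | revert h2]; intro h;
    eapply ex_series_ext;
    [intro n; symmetry; apply Cmod_mult | | intro n; symmetry; apply Cmod_mult |];
    now apply (ex_series_scal_l (V := R_NormedModule)).
Qed.

Lemma Zsummable_succ (f : Z -> C) : Zsummable (fun j => f (j + 1)%Z) <-> Zsummable f.
Proof.
  unfold Zsummable.
  rewrite (ex_series_incr_1 (K := R_AbsRing) (V := R_NormedModule) (fun n => Cmod (f (Z.of_nat n)))).
  rewrite (ex_series_incr_1 (K := R_AbsRing) (V := R_NormedModule)
             (fun n => Cmod (f (- Z.of_nat (S n) + 1)%Z))).
  split; intros [h1 h2]; split;
    [revert h1 | revert h2 | revert h1 | revert h2];
    apply ex_series_ext; intro n; do 2 f_equal; lia.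
Qed.

(** The shift moves one term, [f 0], from one half of the sum to the other. *)
Lemma Zsum_succ (f : Z -> C) : Zsummable f -> Zsum (fun j => f (j + 1)%Z) = Zsum f.
Proof.
  intros hf. destruct (proj2 (Zsummable_succ f) hf) as [_ h2]. destruct hf as [h1 _].
  unfold Zsum. rewrite (Cseries_incr_1 _ h1), (Cseries_incr_1 _ h2). cbn beta.
  rewrite (Cseries_ext (fun n => f (Z.of_nat n + 1)%Z) (fun n => f (Z.of_nat (S n))))
    by (intro; f_equal; lia).
  rewrite (Cseries_ext (fun n => f (- Z.of_nat (S (S n)) + 1)%Z)
             (fun n => f (- Z.of_nat (S n))%Z)) by (intro; f_equal; lia).
  simpl Z.of_nat. simpl Z.add. ring.
Qed.

Lemma Zsum_shift (a : Z) (f : Z -> C) :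
  Zsummable f -> Zsummable (fun j => f (j + a)%Z) /\ Zsum (fun j => f (j + a)%Z) = Zsum f.
Proof.
  intro hf.
  assert (e : forall b j, (j + 1 + b = j + (b + 1))%Z) by (intros; ring).
  induction a as [|a [IH1 IH2]|a [IH1 IH2]] using Z.peano_ind.
  - split; [apply (Zsummable_ext f); [|exact hf] | apply Zsum_ext];
      intro j; now rewrite Z.add_0_r.
  - rewrite <- Z.add_1_r, <- IH2, <- (Zsum_succ _ IH1). split.
    + apply Zsummable_succ in IH1. revert IH1. apply Zsummable_ext. intro j. now rewrite e.
    + apply Zsum_ext. intro j. now rewrite e.
  - rewrite <- Z.sub_1_r.
    assert (h : Zsummable (fun j => f (j + (a - 1))%Z)).
    { apply Zsummable_succ. revert IH1. apply Zsummable_ext. intro j. f_equal. ring. }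
    split; [exact h|]. rewrite <- IH2, <- (Zsum_succ _ h).
    apply Zsum_ext. intro j. f_equal. ring.
Qed.

(** The reflection about -1/2 only exchanges the two halves by which [Zsum] is
    defined; every other reflection is a translate of this one. *)
Lemma Zsum_reflect (a : Z) (f : Z -> C) :
  Zsummable f -> Zsum (fun j => f (a - j)%Z) = Zsum f.
Proof.
  intro hf. rewrite <- (proj2 (Zsum_shift (a + 1) f hf)).
  unfold Zsum. rewrite Cplus_comm.
  f_equal; apply Cseries_ext; intro n; f_equal; lia.
Qed.

(** * Gaussian convergence *)

(** The difference of the two sides is [- A] times the square that completes the
    quadratic polynomial [A * x * x + (b + 1) * x]. *)
Lemma quad_le (A b c x : R) : (A < 0)%R ->
  (A * x * x + b * x + c <= (b + 1) * (b + 1) / (- 4 * A) + c - x)%R.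
Proof.
  intro hA.
  assert (0 <= - A * ((x + (b+1)/(2*A)) * (x + (b+1)/(2*A))))%R
    by (apply Rmult_le_pos; [lra | apply Rle_0_sqr]).
  replace (- A * ((x + (b+1)/(2*A)) * (x + (b+1)/(2*A))))%R
    with ((b + 1) * (b + 1) / (- 4 * A) + c - x - (A * x * x + b * x + c))%R in H
    by (field; lra).
  lra.
Qed.

Lemma exp_monotone (x y : R) : (x <= y)%R -> (exp x <= exp y)%R.
Proof. intros [h|h]; [left; now apply exp_increasing | right; now subst]. Qed.

Lemma exp_pow (x : R) (n : nat) : (exp x ^ n = exp (INR n * x))%R.
Proof.
  induction n as [|n IH]; [simpl; now rewrite Rmult_0_l, exp_0|].
  rewrite S_INR. simpl pow. rewrite IH, <- exp_plus. f_equal. ring.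
Qed.

(** By [quad_le], a Gaussian is dominated by the geometric series of ratio
    [exp (-1)]. *)
Lemma ex_series_gauss (A b c K : R) (N : nat) (u : nat -> C) : (A < 0)%R ->
  (forall n, (N <= n)%nat ->
     (Cmod (u n) <= K * exp (A * INR n * INR n + b * INR n + c))%R) ->
  ex_series (fun n => Cmod (u n)).
Proof.
  intros hA hu. apply (ex_series_incr_n (K:=R_AbsRing) (V:=R_NormedModule) _ N).
  set (D := ((b + 1) * (b + 1) / (- 4 * A) + c)%R).
  apply (ex_series_le (K:=R_AbsRing) (V := R_CompleteNormedModule) _
    (fun n => (Rabs K * exp D * exp (- INR N)) * (exp (-1)) ^ n)%R).
  - intro n. change (norm ?x) with (Rabs x). rewrite Rabs_pos_eq by apply Cmod_ge_0.
    eapply Rle_trans; [apply hu; lia|].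
    eapply Rle_trans; [apply Rmult_le_compat_r; [apply Rlt_le, exp_pos|apply Rle_abs]|].
    rewrite !Rmult_assoc. apply Rmult_le_compat_l; [apply Rabs_pos|].
    rewrite exp_pow, <- !exp_plus. apply exp_monotone.
    pose proof (quad_le A b c (INR (N + n)) hA) as hq. fold D in hq.
    rewrite plus_INR in *. lra.
  - apply (ex_series_scal_l (V := R_NormedModule)), ex_series_geom.
    rewrite Rabs_pos_eq by apply Rlt_le, exp_pos.
    rewrite <- exp_0. apply exp_increasing. lra.
Qed.

(** The common shape of all sums below: an exponential that is quadratic in [j],
    times a factor that is bounded outside finitely many [j].  The
    terms at [- (n + 1)] are those of another quadratic exponential in [n]. *)
Lemma Zsummable_gauss (A B D : C) (g : Z -> C) (K : R) (N : Z) : (Re A < 0)%R ->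
  (forall j : Z, (N <= Z.abs j)%Z -> (Cmod (g j) <= K)%R) ->
  Zsummable (fun j => cexp (A * j * j + B * j + D) * g j).
Proof.
  intros hA hg.
  assert (e : forall j : Z, Re (A * j * j + B * j + D)
            = (Re A * IZR j * IZR j + Re B * IZR j + Re D)%R)
    by (intro j; unfold ZtoC; rewrite !re_plus, !re_scal_r; ring).
  split.
  - apply (ex_series_gauss (Re A) (Re B) (Re D) K (Z.to_nat N)); [exact hA|].
    intros n hn. rewrite Cmod_mult, Cmod_cexp, e, Rmult_comm, <- INR_IZR_INZ.
    apply Rmult_le_compat_r; [apply Rlt_le, exp_pos | apply hg; lia].
  - apply (ex_series_gauss (Re A) (2 * Re A - Re B) (Re A - Re B + Re D) K (Z.to_nat N)); [exact hA|].
    intros n hn. rewrite Cmod_mult, Cmod_cexp, e, Rmult_comm, opp_IZR, <- INR_IZR_INZ, S_INR.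
    replace (Re A * - (INR n + 1) * - (INR n + 1) + Re B * - (INR n + 1) + Re D)%R
      with (Re A * INR n * INR n + (2 * Re A - Re B) * INR n + (Re A - Re B + Re D))%R by ring.
    apply Rmult_le_compat_r; [apply Rlt_le, exp_pos | apply hg; lia].
Qed.

Lemma pole_bound (w : C) : (Cmod w <= 1 / 2 \/ 2 <= Cmod w)%R ->
  (Cmod (/ (1 + w)) <= 2)%R.
Proof.
  intro h.
  assert (h2 : (1 / 2 <= Cmod (1 + w))%R).
  { pose proof (Cmod_triangle (1 + w) (- w)) as t1.
    pose proof (Cmod_triangle (1 + w) (- (1))) as t2.
    replace (1 + w + - w) with (RtoC 1) in t1 by ring.
    replace (1 + w + - (1)) with w in t2 by ring.
    rewrite Cmod_opp in t1, t2. rewrite Cmod_1 in t1, t2. lra. }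
  rewrite Cmod_inv.
  - replace 2%R with (/ (1 / 2))%R by lra. apply Rinv_le_contravar; lra.
  - intro e. rewrite e, Cmod_0 in h2. lra.
Qed.

(** [Cmod (cexp (a * j + b))] tends to 0 in one direction and to infinity in the
    other, so [s * cexp (a * j + b)] leaves the annulus around the unit circle. *)
Lemma pole_bound_far (s : sgn) (a b : C) : Re a <> 0%R ->
  exists N : Z, forall j : Z, (N <= Z.abs j)%Z ->
    (Cmod (/ (1 + s * cexp (a * j + b))) <= 2)%R.
Proof.
  intro ha.
  set (x := ((Rabs (Re b) + 2) / Rabs (Re a))%R).
  (* For [|j| >= x] the exponent is at least 2 in absolute value, and
     [exp 2 >= 2], hence [exp (-2) <= 1 / 2]. *)
  exists (up x). intros j hj. apply pole_bound.
  assert (e : Cmod (s * cexp (a * j + b)) = exp (Re a * IZR j + Re b)).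
  { rewrite Cmod_mult, Cmod_cexp. unfold ZtoC. rewrite re_plus, re_scal_r.
    destruct s; simpl sgnC; rewrite ?Cmod_opp, Cmod_1; ring. }
  rewrite e.
  assert (hx : (Rabs (Re b) + 2 <= Rabs (Re a * IZR j))%R).
  { rewrite Rabs_mult, <- abs_IZR.
    pose proof (archimed x) as [h _]. apply IZR_le in hj.
    assert (0 < Rabs (Re a))%R by now apply Rabs_pos_lt.
    replace (Rabs (Re b) + 2)%R with (Rabs (Re a) * x)%R by (unfold x; field; lra).
    apply Rmult_le_compat_l; lra. }
  pose proof (exp_ineq1_le 2) as e2.
  pose proof (exp_plus 2 (-2)) as e3. replace (2 + -2)%R with 0%R in e3 by ring.
  rewrite exp_0 in e3. pose proof (exp_pos (-2)).
  assert (exp (-2) <= 1 / 2)%R by nra.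
  pose proof (Rle_abs (Re b)). pose proof (Rabs_maj2 (Re b)).
  unfold Rabs in hx at 2. destruct (Rcase_abs (Re a * IZR j)).
  - left. apply Rle_trans with (exp (-2)); [apply exp_monotone; lra|lra].
  - right. apply Rle_trans with (exp 2); [lra|apply exp_monotone; lra].
Qed.

Lemma re_2pi_i (w : C) : Re (2 * PI * Ci * w) = (- (2 * PI) * Im w)%R.
Proof. destruct w; simpl; ring. Qed.

Lemma re_2pi_i_neg (m tau : C) : Im m = 0%R -> (0 < Re m)%R -> (0 < Im tau)%R ->
  (Re (2 * PI * Ci * (m * tau)) < 0)%R.
Proof.
  intros h1 h2 h3. rewrite re_2pi_i, im_mult, h1. pose proof PI_RGT_0.
  pose proof (Rmult_lt_0_compat _ _ h2 h3). nra.
Qed.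

(** * Parity of theta functions *)

Lemma Zsummable_vartheta (a b : Z) (tau z : C) : (0 < Im tau)%R ->
  Zsummable (fun n => cexp (PI * Ci * ((n + a / 2) * (n + a / 2)) * tau
                       + 2 * PI * Ci * (n + a / 2) * (z + b / 2))).
Proof.
  intro htau.
  eapply Zsummable_ext; [|apply (Zsummable_gauss (2 * PI * Ci * (1 / 2 * tau))
    (PI * Ci * (a * tau) + 2 * PI * Ci * (z + b / 2))
    (PI * Ci * (a / 2 * (a / 2)) * tau + 2 * PI * Ci * (a / 2) * (z + b / 2))
    (fun _ => 1) 1 0)].
  - intro n. cbn beta. rewrite Cmult_1_r. f_equal. field.
  - apply re_2pi_i_neg; [simpl; field | simpl | exact htau]. lra.
  - intros j _. rewrite Cmod_1. lra.
Qed.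

(** Replace [n] by [- a - n], which changes the sign of [n + a / 2]; the term then
    changes by [cexp (2 * PI * Ci * (n + a / 2) * b)], that is by the sign
    [(-1) ^ (a * b)]. *)
Lemma vartheta_opp (a b : Z) (tau z : C) : (0 < Im tau)%R ->
  vartheta a b tau (- z) = powerRZ (-1) (a * b) * vartheta a b tau z.
Proof.
  intro htau. unfold vartheta at 2.
  rewrite <- Zsum_scal by now apply Zsummable_vartheta.
  rewrite <- (Zsum_reflect (- a)) by now apply Zsummable_scal, Zsummable_vartheta.
  unfold vartheta. apply Zsum_ext. intro n.
  assert (e : cexp (2 * PI * Ci * (n * b)%Z) = 1).
  { replace (2 * PI * Ci * (n * b)%Z) with (PI * Ci * (2 * (n * b))%Z)
      by (unfold ZtoC; rewrite (mult_IZR 2), RtoC_mult; ring).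
    rewrite cexp_piZ, <- Z.add_diag, powerRZ_add, RtoC_mult by lra.
    apply powerRZ_m1_sqr. }
  rewrite <- cexp_piZ, <- cexp_add.
  rewrite <- (Cmult_1_r (cexp (PI * Ci * _ + _))), <- e, <- cexp_add. f_equal.
  unfold ZtoC. rewrite !minus_IZR, !opp_IZR, !mult_IZR, !RtoC_minus, !RtoC_opp, !RtoC_mult.
  field.
Qed.

(** * The affine numerators as Appell functions *)

(** The shift of the arguments of Phi which turns its denominators [1 - x] into
    the denominators [1 + s * x] of the (super)character. *)
Definition eps (s : sgn) : R := match s with Plus => 1 / 2 | Minus => 0 end.

Lemma cexp_eps (s : sgn) : cexp (2 * PI * Ci * eps s) = - s.
Proof.
  destruct s; cbn [eps sgnC].
  - replace (2 * PI * Ci * (1 / 2)%R) with (PI * Ci * 1%Z).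
    + rewrite cexp_piZ, powerRZ_1. apply C_eq; simpl; ring.
    + unfold ZtoC. rewrite RtoC_div by lra. field.
  - replace (2 * PI * Ci * 0) with (RtoC 0) by ring. rewrite cexp_0. ring.
Qed.

Lemma transl_theta_hpt (j : Z) (tau z1 z2 t : C) :
  transl (- (j) *: theta)%h (hpt tau (beta z1 z2) t) =
  hpt tau (beta (z1 - j * tau) (z2 + j * tau)) (t + j * j * tau + j * (z2 - z1)).
Proof.
  unfold hpt; generalize (RtoC 2 * PI * Ci) as c; intro c; rewrite !betaE.
  unfold transl, theta, alpha3, hdot, hopp, hscal, hadd;
    cbn [cLam ca1 ca2 cdel alpha1 alpha2 Lambda0 delta].
  f_equal; field.
Qed.

Lemma r_theta_hpt (tau z1 z2 t : C) :
  r_theta (hpt tau (beta z1 z2) t) = hpt tau (beta z2 z1) t.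
Proof.
  unfold hpt; generalize (RtoC 2 * PI * Ci) as c; intro c; rewrite !betaE.
  unfold r_theta, theta, alpha3, hdot, hopp, hscal, hadd;
    cbn [cLam ca1 ca2 cdel alpha1 alpha2 Lambda0 delta].
  f_equal; ring.
Qed.

Lemma hexp_weight (m m2 : Z) (tau z1 z2 t : C) :
  hexp (Lambda_mm2 m m2 + rho)%h (hpt tau (beta z1 z2) t)
  = cexp (2 * PI * Ci * (m * t - (m2 - 1) * z1)).
Proof.
  unfold hexp; f_equal.
  unfold hpt; generalize (RtoC 2 * PI * Ci) as c; intro c; rewrite !betaE.
  unfold Lambda_mm2, rho, alpha3, hdot, hopp, hscal, hadd;
    cbn [cLam ca1 ca2 cdel alpha1 alpha2 Lambda0 delta].
  field.
Qed.

Lemma hexp_odd (tau z1 z2 t : C) :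
  hexp (- alpha1)%h (hpt tau (beta z1 z2) t) = cexp (2 * PI * Ci * z1).
Proof.
  unfold hexp; f_equal.
  unfold hpt; generalize (RtoC 2 * PI * Ci) as c; intro c; rewrite !betaE.
  unfold hdot, hopp, hscal, hadd;
    cbn [cLam ca1 ca2 cdel alpha1 alpha2 Lambda0 delta].
  ring.
Qed.

(** The translation by [- j * theta] is kept instead of being reindexed, so that
    [Fterm] is the summand of [Fsum] verbatim; [Fsum_pair] reflects [j]. *)
Definition Fterm (s : sgn) (m m2 : Z) (tau z1 z2 t : C) (j : Z) : C :=
  let x := cexp (2 * PI * Ci * (z1 - j * tau)) in
  cexp (2 * PI * Ci *
    (m * (t + j * j * tau + j * (z2 - z1)) - (m2 - 1) * (z1 - j * tau)))
  / ((1 + s * x) * (1 + s * x)).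

Lemma Fsum_hpt (s : sgn) (m m2 : Z) (tau z1 z2 t : C) :
  Fsum s m m2 (hpt tau (beta z1 z2) t) = Zsum (Fterm s m m2 tau z1 z2 t).
Proof.
  unfold Fsum. apply Zsum_ext. intro j.
  change alpha3 with alpha1. rewrite transl_theta_hpt, hexp_weight, hexp_odd.
  reflexivity.
Qed.

Lemma Zsummable_Fterm (s : sgn) (m m2 : Z) (tau z1 z2 t : C) :
  (0 < m)%Z -> (0 < Im tau)%R -> Zsummable (Fterm s m m2 tau z1 z2 t).
Proof.
  intros hm htau.
  destruct (pole_bound_far s (- (2 * PI * Ci * (1 * tau))) (2 * PI * Ci * z1)) as [N hN].
  { rewrite re_opp.
    pose proof (re_2pi_i_neg 1 tau eq_refl Rlt_0_1 htau). lra. }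
  eapply Zsummable_ext; [|apply (Zsummable_gauss (2 * PI * Ci * (m * tau))
    (2 * PI * Ci * (m * (z2 - z1) + (m2 - 1) * tau))
    (2 * PI * Ci * (m * t - (m2 - 1) * z1))
    (fun j => / ((1 + s * cexp (2 * PI * Ci * (z1 - j * tau)))
                * (1 + s * cexp (2 * PI * Ci * (z1 - j * tau))))) 4 N)].
  - intro j. unfold Fterm, Cdiv. f_equal. f_equal. ring.
  - apply re_2pi_i_neg; [reflexivity | simpl; now apply IZR_lt | exact htau].
  - intros j hj. specialize (hN j hj).
    replace (- (2 * PI * Ci * (1 * tau)) * j + 2 * PI * Ci * z1)
      with (2 * PI * Ci * (z1 - j * tau)) in hN by ring.
    rewrite Cinv_mult, Cmod_mult.
    pose proof (Cmod_ge_0 (/ (1 + s * cexp (2 * PI * Ci * (z1 - j * tau))))). nra.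
Qed.

Lemma Zsummable_Phi1 (m s : R) (tau z1 z2 : C) : (0 < m)%R -> (0 < Im tau)%R ->
  Zsummable (fun j : Z =>
    cexp (2 * PI * Ci * m * j * (z1 + z2) + 2 * PI * Ci * s * z1)
    * qpow tau (m * j * j + s * j)
    / (1 - cexp (2 * PI * Ci * z1) * qpow tau j)).
Proof.
  intros hm htau.
  destruct (pole_bound_far Minus (2 * PI * Ci * (1 * tau)) (2 * PI * Ci * z1)) as [N hN].
  { pose proof (re_2pi_i_neg 1 tau eq_refl Rlt_0_1 htau). lra. }
  eapply Zsummable_ext; [|apply (Zsummable_gauss (2 * PI * Ci * (m * tau))
    (2 * PI * Ci * (m * (z1 + z2) + s * tau))
    (2 * PI * Ci * (s * z1))
    (fun j => / (1 - cexp (2 * PI * Ci * z1) * qpow tau j)) 2 N)].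
  - intro j. unfold qpow, Cdiv. rewrite <- (cexp_add (_ + _)). f_equal. f_equal. ring.
  - now apply re_2pi_i_neg.
  - intros j hj. specialize (hN j hj).
    replace (1 - cexp (2 * PI * Ci * z1) * qpow tau j)
      with (1 + Minus * cexp (2 * PI * Ci * (1 * tau) * j + 2 * PI * Ci * z1)); [exact hN|].
    rewrite cexp_add. unfold qpow. simpl sgnC.
    replace (2 * PI * Ci * (1 * tau) * j) with (2 * PI * Ci * tau * j) by ring. ring.
Qed.

(** The two numerators add up to [s * (1 + s * x)] times an exponential, which
    cancels one of the two equal factors of the denominator. *)
Lemma Fsum_pair (s : sgn) (m m2 : Z) (tau z1 z2 t : C) :
  (0 < m)%Z -> (0 < Im tau)%R ->
  Fsum s m m2 (hpt tau (beta z1 z2) t) + s * Fsum s m (m2 + 1) (hpt tau (beta z1 z2) t)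
  = s * cexp (2 * PI * Ci * m2 * eps s)
    * Phi1 (IZR m) (IZR (- m2)) tau (z1 + eps s) (- z2 - eps s) (- t).
Proof.
  intros hm htau. assert (hmR : (0 < IZR m)%R) by now apply IZR_lt.
  rewrite !Fsum_hpt, <- Zsum_scal, <- Zsum_plus
    by repeat (apply Zsummable_scal || apply Zsummable_Fterm || assumption).
  unfold Phi1. rewrite Cmult_assoc.
  rewrite <- Zsum_scal by now apply Zsummable_Phi1.
  symmetry. rewrite <- (Zsum_reflect 0) by now apply Zsummable_scal, Zsummable_Phi1.
  symmetry. apply Zsum_ext. intro j.
  unfold Fterm, qpow. cbn [Z.sub Z.add].
  set (x := cexp (2 * PI * Ci * (z1 - j * tau))).
  assert (ed : 1 - cexp (2 * PI * Ci * (z1 + eps s)) * cexp (2 * PI * Ci * tau * (- j)%Z)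
             = 1 + s * x).
  { replace (2 * PI * Ci * (z1 + eps s))
      with (2 * PI * Ci * z1 + 2 * PI * Ci * eps s) by ring.
    unfold x. replace (2 * PI * Ci * (z1 - j * tau))
      with (2 * PI * Ci * z1 + 2 * PI * Ci * tau * (- j)%Z)
      by (unfold ZtoC; rewrite opp_IZR, RtoC_opp; ring).
    rewrite !cexp_add, cexp_eps. ring. }
  rewrite ed.
  set (w := 2 * PI * Ci * (m * (t + j * j * tau + j * (z2 - z1)) - m2 * (z1 - j * tau))).
  replace (2 * PI * Ci * (m * (t + j * j * tau + j * (z2 - z1)) - (m2 - 1) * (z1 - j * tau)))
    with (w + 2 * PI * Ci * (z1 - j * tau)) by (unfold w; ring).
  replace (2 * PI * Ci * (m * (t + j * j * tau + j * (z2 - z1)) - ((m2 + 1)%Z - 1) * (z1 - j * tau)))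
    with w by (unfold w, ZtoC; rewrite plus_IZR, RtoC_plus; ring).
  rewrite cexp_add. fold x.
  set (D := 1 + s * x).
  replace (cexp w * x / (D * D) + s * (cexp w / (D * D)))
    with (s * cexp w * (D / (D * D)))
    by (unfold Cdiv; generalize (/ (D * D)); intro d; unfold D;
        destruct s; cbn [sgnC]; ring).
  rewrite Cdiv_sqr_self. unfold Cdiv. rewrite !Cmult_assoc, <- (Cmult_assoc s).
  rewrite <- !(Cmult_assoc s), <- !cexp_add. do 3 f_equal. unfold w, ZtoC.
  rewrite !opp_IZR, !RtoC_opp. ring.
Qed.

(** This is why the antisymmetrization by [r_theta], which exchanges [z1] and
    [z2], produces the difference of the two halves of Phi. *)
Lemma Phi2_as_Phi1 (m s : R) (tau z1 z2 t : C) :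
  Phi2 m s tau z1 z2 t = Phi1 m s tau (- z2) (- z1) t.
Proof.
  unfold Phi1, Phi2. f_equal. apply Zsum_ext. intro j.
  replace (2 * PI * Ci * - z2) with (- (2 * PI * Ci * z2)) by ring.
  do 3 f_equal. ring.
Qed.

Lemma L_pair (s : sgn) (m m2 : Z) (tau z1 z2 t : C) :
  (0 < m)%Z -> (0 < Im tau)%R ->
  let h := hpt tau (beta z1 z2) t in
  Rch (L_mm2 m m2) s h + s * Rch (L_mm2 m (m2 + 1)) s h
  = s * cexp (2 * PI * Ci * m2 * eps s)
    * Phi (IZR m) (IZR (- m2)) tau (z1 + eps s) (- z2 - eps s) (- t).
Proof.
  intros hm htau h. unfold h; cbn [Rch L_mm2]. rewrite r_theta_hpt.
  pose proof (Fsum_pair s m m2 tau z1 z2 t hm htau) as e1.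
  pose proof (Fsum_pair s m m2 tau z2 z1 t hm htau) as e2.
  unfold Phi. rewrite Phi2_as_Phi1.
  replace (- (- z2 - eps s)) with (z2 + eps s) by ring.
  replace (- (z1 + eps s)) with (- z1 - eps s) by ring.
  match type of e1 with _ = ?b => match type of e2 with _ = ?d =>
    transitivity (b - d); [rewrite <- e1, <- e2|]; ring end end.
Qed.

Lemma Phi_t (m s : R) (tau z1 z2 t : C) :
  Phi m s tau z1 z2 t = cexp (- (2 * PI * Ci * m * t)) * Phi m s tau z1 z2 0.
Proof.
  unfold Phi, Phi1, Phi2.
  replace (- (2 * PI * Ci * m * 0)) with (RtoC 0) by ring. rewrite cexp_0. ring.
Qed.

(** * Principal admissible weights *)

Lemma two_pi_i_nz : 2 * PI * Ci <> 0.
Proof.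
  pose proof PI_neq0 as h. repeat apply Cmult_neq_0; try exact Ci_nz;
    intro e; apply RtoC_inj in e; lra.
Qed.

Lemma tau_of_hpt (tau z1 z2 t : C) : tau_of (hpt tau (beta z1 z2) t) = tau.
Proof.
  unfold tau_of, hpt. generalize two_pi_i_nz. generalize (2 * PI * Ci).
  intros c hc. rewrite betaE. unfold hscal, hadd; cbn [cLam ca1 ca2 cdel Lambda0 delta]. field. exact hc.
Qed.

Lemma z_of_hpt (tau z1 z2 t : C) : z_of (hpt tau (beta z1 z2) t) = beta z1 z2.
Proof.
  unfold z_of, hpt. generalize two_pi_i_nz. generalize (2 * PI * Ci).
  intros c hc. rewrite betaE. unfold hscal, hadd; cbn [cLam ca1 ca2 cdel Lambda0 delta].
  f_equal; field; exact hc.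
Qed.

Lemma t_of_hpt (tau z1 z2 t : C) : t_of (hpt tau (beta z1 z2) t) = t.
Proof.
  unfold t_of, hpt. generalize two_pi_i_nz. generalize (2 * PI * Ci).
  intros c hc. rewrite betaE. unfold hscal, hadd; cbn [cLam ca1 ca2 cdel Lambda0 delta]. field. exact hc.
Qed.

Lemma beta_line (tau z1 z2 b1 b2 : C) :
  (beta z1 z2 + tau *: beta b1 b2)%h = beta (z1 + tau * b1) (z2 + tau * b2).
Proof. rewrite !betaE. unfold hscal, hadd; cbn [cLam ca1 ca2 cdel]. f_equal; ring. Qed.

Lemma hdot_beta (a1 a2 b1 b2 : C) :
  hdot (beta a1 a2) (beta b1 b2) = - (a1 * b2 + a2 * b1).
Proof. rewrite !betaE. unfold hdot; cbn [cLam ca1 ca2 cdel]. ring. Qed.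

Lemma r_alpha2_beta (z1 z2 : C) : r_alpha2 (beta z1 z2) = beta (- z2) (- z1).
Proof.
  rewrite !betaE. unfold r_alpha2, hdot, hscal, hadd; cbn [cLam ca1 ca2 cdel alpha2]. f_equal; ring.
Qed.

(** Since [ybar] is an isometry, type III is type I with [(z1, z2)] replaced by
    its image [(w1, w2)] under [r_alpha2]. *)
Lemma Rch_L_adm (M m m2 k1 k2 : Z) (ty : heart) (s : sgn) (tau z1 z2 t : C) :
  let w1 := match ty with TypeI => z1 | TypeIII => - z2 end in
  let w2 := match ty with TypeI => z2 | TypeIII => - z1 end in
  Rch (L_adm M m m2 ty k1 k2) s (hpt tau (beta z1 z2) t) =
  Rch (L_mm2 m m2) s
    (hpt (M * tau) (beta (w1 + k1 * tau) (w2 - (k1 + k2) * tau))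
       (1 / M * (t + w1 * (k1 + k2) - w2 * k1 + tau * k1 * (k1 + k2)))).
Proof.
  intros w1 w2. unfold L_adm. cbn [Rch]. rewrite tau_of_hpt, z_of_hpt, t_of_hpt.
  unfold w1, w2. clear w1 w2.
  destruct ty; simpl beta_of; simpl ybar;
    rewrite beta_line, !hdot_beta, ?r_alpha2_beta;
    (apply f_equal, f_equal3; [reflexivity | f_equal; ring | f_equal; field]).
Qed.

(** The three equations say that the translated point is the argument of Phi in
    the definition of Psi at [(w, - w, 0)]; the last one compares the exponential
    prefactors. *)
Lemma Rch_Lddot_Psi (M m m2 k1 k2 : Z) (j k : R) (ty : heart) (s : sgn)
    (tau z1 z2 t w : C) :
  (0 < M)%Z -> (0 < m)%Z -> (0 < Im tau)%R ->
  let w1 := match ty with TypeI => z1 | TypeIII => - z2 end in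
  let w2 := match ty with TypeI => z2 | TypeIII => - z1 end in
  w1 + k1 * tau = w + j * tau ->
  w2 - (k1 + k2) * tau = w - k * tau ->
  t + w1 * (k1 + k2) - w2 * k1 + tau * k1 * (k1 + k2)
    = j * k * tau + (k - j) * w ->
  Rch_Lddot M m m2 ty k1 k2 s (hpt tau (beta z1 z2) t) =
  s * cexp (2 * PI * Ci * m2 * eps s)
    * Psi (IZR M) (IZR m) (IZR (- m2)) (eps s) j k tau w (- w) 0.
Proof.
  intros hM hm htau w1 w2 e1 e2 e3.
  assert (hM0 : RtoC (IZR M) <> 0)
    by (intro e; apply RtoC_inj, eq_IZR in e; lia).
  unfold Rch_Lddot. rewrite !Rch_L_adm. fold w1 w2. rewrite e1, e2, e3.
  rewrite L_pair; [|exact hm|].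
  2:{ unfold ZtoC. rewrite im_scal_l. apply Rmult_lt_0_compat; [now apply IZR_lt|exact htau]. }
  rewrite Phi_t. unfold Psi, qpow, ZtoC.
  replace (0 / IZR M) with (RtoC 0) by (field; exact hM0).
  rewrite <- !Cmult_assoc. do 2 f_equal. rewrite !Cmult_assoc, <- cexp_add.
  replace (- (w - k * tau) - eps s) with (- w + k * tau - eps s) by ring.
  do 2 f_equal. field. exact hM0.
Qed.

(** * Comparison of the N=4 and N=2 characters *)

Lemma cexp_eps_Plus (n : Z) : cexp (2 * PI * Ci * n * eps Plus) = powerRZ (-1) n.
Proof.
  rewrite <- cexp_piZ. f_equal. cbn [eps]. rewrite RtoC_div by lra. field.
Qed.

Lemma cexp_eps_Minus (n : Z) : cexp (2 * PI * Ci * n * eps Minus) = 1.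
Proof.
  cbn [eps]. rewrite <- cexp_0. f_equal. ring.
Qed.

(** The shape of all four N=4 denominators, with [c] equal to [Ci] or [- Ci];
    [th / e] is the inverse of the N=2 denominator. *)
Lemma Cdiv_denominator (c n th e v : C) : c * c = - (1) ->
  n / (c * (e * v / th ^ 2)) = - c * (n * (th / e)) * (th / v).
Proof.
  intro hc. assert (hi : / c = - c).
  { assert (c <> 0). { intro h. rewrite h in hc. injection hc. lra. }
    replace (- c) with (- (c * c) * / c) by (field; assumption).
    rewrite hc. ring. }
  unfold Cdiv. rewrite !Cinv_mult, Cinv_inv, hi. ring.
Qed.

Lemma Ci_sqr : Ci * Ci = - (1).
Proof. apply C_eq; simpl; ring. Qed.

Lemma opp_Ci_sqr : - Ci * - Ci = - (1).
Proof. rewrite <- Ci_sqr. ring. Qed.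

Theorem corollary5p1 (M m m2 : Z) (hM : (0 < M)%Z) (hm : (0 < m)%Z)
  (hcop : Z.gcd M m = 1%Z) (hm2 : (0 <= m2 <= m - 1)%Z)
  (tau z : C) (htau : (0 < Im tau)%R)
  (hz : forall a b : Z, 2 * z <> a + b * tau) :
  (forall k1 k2 : Z, Omega TypeI M k1 k2 ->
     let H2 := N2_H M (m - 1) m2 k1 (k1 + k2) in
     N4_ch Plus M m m2 TypeI k1 k2 tau z
       = Ci * N2_ch H2 Plus tau z
         * (vartheta 0 0 tau z / vartheta 1 1 tau (2 * z)) /\
     N4_ch Minus M m m2 TypeI k1 k2 tau z
       = Ci * N2_ch H2 Minus tau z
         * (vartheta 0 1 tau z / vartheta 1 1 tau (2 * z))) /\
  (forall k1 k2 : Z, Omega TypeIII M k1 k2 ->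
     let H2 := N2_H M (m - 1) m2 k1 (k1 + k2) in
     N4_ch Plus M m m2 TypeIII k1 k2 tau z
       = Ci * N2_ch H2 Plus tau (- z)
         * (vartheta 0 0 tau z / vartheta 1 1 tau (2 * z)) /\
     N4_ch Minus M m m2 TypeIII k1 k2 tau z
       = Ci * N2_ch H2 Minus tau (- z)
         * (vartheta 0 1 tau z / vartheta 1 1 tau (2 * z))) /\
  (forall k1 k2 : Z, Omega TypeI M k1 k2 ->
     let H2 := N2_H M (m - 1) m2 k1 (k1 + k2) in
     N4_ch_tw Plus M m m2 TypeI k1 k2 tau z
       = Ci * N2_ch_tw H2 Plus tau (- z)
         * (vartheta 1 0 tau z / vartheta 1 1 tau (2 * z)) /\
     N4_ch_tw Minus M m m2 TypeI k1 k2 tau z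
       = - Ci * N2_ch_tw H2 Minus tau (- z)
         * (vartheta 1 1 tau z / vartheta 1 1 tau (2 * z))).
Proof.
  split; [|split]; intros k1 k2 _ H2; unfold H2, N2_H; clear H2;
    cbn [N2_ch N2_ch_tw];
    replace (m - 1 + 1)%Z with m by ring.
  - assert (num : forall s : sgn, Rch_Lddot M m m2 TypeI k1 k2 s (N4_pt tau z)
      = s * cexp (2 * PI * Ci * m2 * eps s)
        * Psi (IZR M) (IZR m) (IZR (- m2)) (eps s) (IZR k1 + 1 / 2)
            (IZR (k1 + k2) + 1 / 2) tau z (- z) 0).
    { intro s. apply Rch_Lddot_Psi; try assumption; unfold ZtoC;
        rewrite ?plus_IZR, ?RtoC_plus, ?RtoC_div by lra; field. }
    split; unfold N4_ch, N4_R; rewrite num.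
    + rewrite Cdiv_denominator by apply opp_Ci_sqr. rewrite cexp_eps_Plus. cbn [eps sgnC]. ring.
    + rewrite Cdiv_denominator by apply Ci_sqr. rewrite cexp_eps_Minus. cbn [eps sgnC]. ring.
  - assert (num : forall s : sgn, Rch_Lddot M m m2 TypeIII k1 k2 s (N4_pt tau z)
      = s * cexp (2 * PI * Ci * m2 * eps s)
        * Psi (IZR M) (IZR m) (IZR (- m2)) (eps s) (IZR k1 + 1 / 2)
            (IZR (k1 + k2) + 1 / 2) tau (- z) (- - z) 0).
    { intro s. apply Rch_Lddot_Psi; try assumption; unfold ZtoC;
        rewrite ?plus_IZR, ?RtoC_plus, ?RtoC_div by lra; field. }
    split; unfold N4_ch, N4_R; rewrite num, vartheta_opp by exact htau.
    + rewrite Cdiv_denominator by apply opp_Ci_sqr. rewrite cexp_eps_Plus. cbn [eps sgnC Z.mul powerRZ].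
      unfold Cdiv. ring.
    + rewrite Cdiv_denominator by apply Ci_sqr. rewrite cexp_eps_Minus. cbn [eps sgnC Z.mul powerRZ].
      unfold Cdiv. ring.
  - assert (num : forall s : sgn, Rch_Lddot_tw M m m2 TypeI k1 k2 s (N4_pt tau z)
      = s * cexp (2 * PI * Ci * m2 * eps s)
        * Psi (IZR M) (IZR m) (IZR (- m2)) (eps s) (IZR k1 + 1)
            (IZR (k1 + k2)) tau (- z) (- - z) 0).
    { intro s. unfold Rch_Lddot_tw, N4_pt. rewrite w0_hpt.
      apply Rch_Lddot_Psi; try assumption; unfold ZtoC;
        rewrite ?plus_IZR, ?RtoC_plus, ?RtoC_div by lra; field. }
    split; unfold N4_ch_tw, N4_R_tw; rewrite num, vartheta_opp by exact htau.
    + rewrite Cdiv_denominator by apply opp_Ci_sqr. rewrite cexp_eps_Plus. cbn [eps sgnC Z.mul powerRZ].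
      unfold Cdiv. ring.
    + rewrite Cdiv_denominator by apply Ci_sqr. rewrite cexp_eps_Minus. cbn [eps sgnC Z.mul].
      rewrite powerRZ_1. replace (RtoC (-1)) with (- RtoC 1) by (apply C_eq; simpl; ring).
      unfold Cdiv. ring.
Qed.
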